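(* Let $\mathcal{A}=\{A_0,A_1,A_2\}$ be the standard basis of a symmetric rank $3$ standard integral table algebra with character table $$\begin{bmatrix}1&r&m(1+r)\\ 1&r&-1-r\\ 1&-1&0\end{bmatrix},$$ i.e. $k=r$, $s=-1$ and $\ell=m(1+r)$ (as when $A_1$ is the adjacency matrix of a disjoint union of $m+1$ copies of the complete graph $K_{r+1}$). Then each of the following partitions of $\{2,\dots,9\}$ gives a fusion of $\mathcal{A}\otimes\mathcal{A}$: $2|3|4|5|6|78|9$, $2|36|4|5|7|8|9$; $2|3|4|5|6|789$, $2|3|45|6|78|9$, $2|36|4|5|78|9$, $2|369|4|5|7|8$, $25|36|4|7|8|9$; $2|3|45|6|789$, $2|36|45|78|9$, $2|3678|4|5|9$, $2|369|4|5|78$, $24|36|5|78|9$, $2|36|4|5|789$, $25|36|4|78|9$, $25|369|4|7|8$; $2|36|45|789$, $25|369|4|78$, $2|3|456|789$, $2|36789|4|5$, $258|369|4|7$, $2|3|4578|69$, $23|4|56|789$, $245|36|78|9$, $2356|4|7|89$, $2|369|47|58$, $2|3678|45|9$, $2|369|45|78$, $24|3678|5|9$, $25|36|4|789$, $25|3678|4|9$, $24|36|5|789$, $24|369|5|78$; $2|3456|789$, $2|36789|45$, $24|36789|5$, $2578|4|369$, $2356|4|789$, $245|36|789$, $245|369|78$, $25|36789|4$, $245|3678|9$, $2|369|4578$; $2|3456789$, $23456|789$, $2356789|4$, $24578|369$, $245|36789$.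
   Context: A symmetric rank $3$ standard integral table algebra is a commutative associative complex algebra with basis $A_0=1,A_1,A_2$ such that the structure constants $\lambda_{ijh}$ ($A_iA_j=\sum_h\lambda_{ijh}A_h$) are nonnegative reals, $\lambda_{ij0}=0$ for $i\neq j$, and $\lambda_{ii0}=\delta(A_i)$ is a positive integer, where $\delta$ is the valency homomorphism. Main example: $A_0=I_n$, $A_1$ the adjacency matrix of a strongly regular graph, $A_2=J-I-A_1$. With $k=\delta(A_1)$, $\ell=\delta(A_2)$, the character table (rows: characters $\chi_0=\delta,\chi_1,\chi_2$; columns: $A_0,A_1,A_2$) has the form $[1,k,\ell;\,1,r,-1-r;\,1,s,-1-s]$. The tensor square $\mathcal{A}\otimes\mathcal{A}$ has basis $A_{ij}=A_i\otimes A_j$, relabelled $C_{3j+i+1}=A_{ij}$: $C_1=A_{00},C_2=A_{10},C_3=A_{20},C_4=A_{01},C_5=A_{11},C_6=A_{21},C_7=A_{02},C_8=A_{12},C_9=A_{22}$. Partitions of $\{2,\dots,9\}$ are written with blocks separated by bars. A partition $\tau$ gives a fusion of $\mathcal{A}\otimes\mathcal{A}$ if the span of $C_1$ and the block sums $\sum_{t\in T}C_t$ ($T$ a block of $\tau$) is closed under multiplication. *)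

(* Defs.v *)
From HB Require Import structures.
From mathcomp Require Import all_boot all_order all_algebra all_field.
From mathcomp Require Import complex reals.

Set Implicit Arguments.
Unset Strict Implicit.
Unset Printing Implicit Defensive.

Import GRing.Theory Num.Theory.

Local Open Scope ring_scope.

(* The tensor product of two finite-dimensional algebras A and B is realized
   on coordinate matrices with respect to the bases of A and B chosen by
   vbasis. tensorE, tensorM and tensor_univ show that the result does not
   depend on this choice: pure tensors span, multiply factorwise, and have the
   universal property for bilinear maps. *)
Definition tensor_alg (K : fieldType) (A B : falgType K) : Type :=
  'M[K]_(\dim {:A}, \dim {:B}).

Section TensorAlgebra.
Variables (K : fieldType) (A B : falgType K).
Local Notation T := (tensor_alg A B).

HB.instance Definition _ :=
  Vector.copy T 'M[K]_(\dim {:A}, \dim {:B}).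

Local Notation e i := ((vbasis {:A})`_i).
Local Notation f j := ((vbasis {:B})`_j).

Definition tensor (a : A) (b : B) : T :=
  \matrix_(i, j) (coord (vbasis {:A}) i a * coord (vbasis {:B}) j b).

Lemma tensor_linearl b : linear (tensor^~ b).
Proof.
by move=> c a a'; apply/matrixP => i j; rewrite !mxE linearP mulrDl mulrA.
Qed.

Lemma tensor_linearr a : linear (tensor a).
Proof.
move=> c b b'; apply/matrixP => i j.
by rewrite !mxE linearP mulrDr mulrCA.
Qed.

HB.instance Definition _ a :=
  GRing.isLinear.Build K B T *:%R (tensor a) (tensor_linearr a).

Lemma tensorE (x : T) : x = \sum_i \sum_j x i j *: tensor (e i) (f j).
Proof.
apply/matrixP => k l; rewrite summxE (bigD1 k) //= summxE (bigD1 l) //=.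
have fA := basis_free (vbasisP {:A}); have fB := basis_free (vbasisP {:B}).
rewrite !mxE !coord_free // !eqxx !mulr1 !big1 ?addr0 //.
  move=> i ik; rewrite summxE big1 // => j _.
  by rewrite !mxE !coord_free // (negPf ik) mul0r mulr0.
by move=> j jl; rewrite !mxE !coord_free // (negPf jl) !mulr0.
Qed.

Definition tensor_lift (W : lmodType K) (g : A -> B -> W) (x : T) : W :=
  \sum_i \sum_j x i j *: g (e i) (f j).

Lemma tensor_lift_linear (W : lmodType K) (g : A -> B -> W) :
  linear (tensor_lift g).
Proof.
move=> c x y; rewrite /tensor_lift scaler_sumr -big_split; apply: eq_bigr => i _.
rewrite /= scaler_sumr -big_split; apply: eq_bigr => j _ /=.
by rewrite !mxE scalerDl scalerA.
Qed.

Lemma tensor_liftE (W : lmodType K) (g : A -> B -> W) :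
    (forall b, linear (g^~ b)) -> (forall a, linear (g a)) ->
  forall a b, tensor_lift g (tensor a b) = g a b.
Proof.
move=> gl gr a b.
pose gL b := GRing.isLinear.Build K A W *:%R (g^~ b) (gl b).
pose gLb b : {linear A -> W} := HB.pack (g^~ b) (gL b).
pose gR a := GRing.isLinear.Build K B W *:%R (g a) (gr a).
pose gRa a : {linear B -> W} := HB.pack (g a) (gR a).
rewrite /tensor_lift {2}(coord_vbasis (memvf a)).
rewrite -[RHS]/(gLb b _) linear_sum; apply: eq_bigr => i _.
rewrite linearZ /= -[X in _ *: X]/(gRa (e i) b) {2}(coord_vbasis (memvf b)).
rewrite linear_sum scaler_sumr; apply: eq_bigr => j _.
by rewrite linearZ /= !mxE scalerA.
Qed.

Lemma tensor_univ (W : lmodType K) (g : A -> B -> W) :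
    (forall b, linear (g^~ b)) -> (forall a, linear (g a)) ->
  exists2 h : T -> W, linear h /\ (forall a b, h (tensor a b) = g a b)
    & forall h' : T -> W,
        linear h' -> (forall a b, h' (tensor a b) = g a b) -> h' =1 h.
Proof.
move=> gl gr; exists (tensor_lift g); first split.
- exact: tensor_lift_linear.
- exact: tensor_liftE.
move=> h' lh' h'E x.
pose hL := GRing.isLinear.Build K T W *:%R h' lh'.
pose H : {linear T -> W} := HB.pack h' hL.
rewrite {1}[x]tensorE -[h']/(H : T -> W) linear_sum; apply: eq_bigr => i _.
rewrite linear_sum; apply: eq_bigr => j _.
by rewrite linearZ /= h'E.
Qed.

Definition tensor_mul (x y : T) : T :=
  tensor_lift (fun a b => tensor_lift (fun a' b' => tensor (a * a') (b * b')) y) x.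

Definition tensor_one : T := tensor 1 1.

Let mulA_lin (a : A) (b : B) (a0 : A) (b0 : B) :
  tensor_lift (fun a' b' => tensor (a * a') (b * b')) (tensor a0 b0)
    = tensor (a * a0) (b * b0).
Proof.
by apply: tensor_liftE => [b'|a'] c x y;
  rewrite mulrDr -scalerAr (tensor_linearl, tensor_linearr).
Qed.

Lemma tensor_mulr_linear x : linear (tensor_mul x).
Proof.
move=> c y z; rewrite /tensor_mul [in RHS]/tensor_lift scaler_sumr -big_split.
apply: eq_bigr => i _; rewrite /= scaler_sumr -big_split; apply: eq_bigr => j _.
by rewrite /= tensor_lift_linear scalerDr !scalerA mulrC.
Qed.

Lemma tensor_mull_linear y : linear (tensor_mul^~ y).
Proof. by move=> c x x'; rewrite /tensor_mul tensor_lift_linear. Qed.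

Lemma tensor_mulE a b a' b' :
  tensor_mul (tensor a b) (tensor a' b') = tensor (a * a') (b * b').
Proof.
rewrite /tensor_mul tensor_liftE ?mulA_lin // => [b0|a0] c x y.
  rewrite /tensor_lift scaler_sumr -big_split; apply: eq_bigr => i _.
  rewrite /= scaler_sumr -big_split; apply: eq_bigr => j _ /=.
  rewrite mulrDl -scalerAl tensor_linearl scalerDr !scalerA.
  by rewrite [c * _]mulrC.
rewrite /tensor_lift scaler_sumr -big_split; apply: eq_bigr => i _.
rewrite /= scaler_sumr -big_split; apply: eq_bigr => j _ /=.
by rewrite mulrDl -scalerAl tensor_linearr scalerDr !scalerA [c * _]mulrC.
Qed.

Lemma tensor_ind (P : T -> Prop) :
    (forall a b, P (tensor a b)) ->
    (forall c x y, P x -> P y -> P (c *: x + y)) -> forall x, P x.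
Proof.
move=> Pt PD.
have P0 : P 0 by have := Pt 0 0; rewrite linear0.
move=> x; rewrite [x]tensorE; apply: big_ind => [|y z Py Pz|i _] //.
  by rewrite -[y]scale1r; apply: PD.
apply: big_ind => [|y z Py Pz|j _] //; first by rewrite -[y]scale1r; apply: PD.
by rewrite -[_ *: _]addr0; apply: PD.
Qed.

Lemma tensor_mulA : associative tensor_mul.
Proof.
move=> x y z; elim/tensor_ind: x => [a b|c x x' IHx IHx']; last first.
  by rewrite !tensor_mull_linear IHx IHx'.
elim/tensor_ind: y => [a' b'|c y y' IHy IHy']; last first.
  by rewrite tensor_mulr_linear !tensor_mull_linear tensor_mulr_linear IHy IHy'.
elim/tensor_ind: z => [a'' b''|c z z' IHz IHz']; last first.
  by rewrite !tensor_mulr_linear IHz IHz'.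
by rewrite !tensor_mulE !mulrA.
Qed.

Lemma tensor_mul1 : left_id tensor_one tensor_mul.
Proof.
elim/tensor_ind=> [a b|c x y IHx IHy]; first by rewrite tensor_mulE !mul1r.
by rewrite tensor_mulr_linear IHx IHy.
Qed.

Lemma tensor_mulr1 : right_id tensor_one tensor_mul.
Proof.
elim/tensor_ind=> [a b|c x y IHx IHy]; first by rewrite tensor_mulE !mulr1.
by rewrite tensor_mull_linear IHx IHy.
Qed.

Lemma tensor_mulDl : left_distributive tensor_mul +%R.
Proof.
by move=> x y z; have := tensor_mull_linear z 1 x y; rewrite !scale1r.
Qed.

Lemma tensor_mulDr : right_distributive tensor_mul +%R.
Proof.
by move=> x y z; have := tensor_mulr_linear x 1 y z; rewrite !scale1r.
Qed.

Lemma tensor_eq0 a b : tensor a b = 0 -> a = 0 \/ b = 0.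
Proof.
move=> /matrixP t0; case: (eqVneq a 0) => [|a0]; [by left | right].
have [i ai] : exists i, coord (vbasis {:A}) i a != 0.
  apply/existsP; apply: contraR a0; rewrite negb_exists => /forallP a0.
  rewrite (coord_vbasis (memvf a)) big1 // => i _.
  by have := a0 i; rewrite negbK => /eqP->; rewrite scale0r.
rewrite (coord_vbasis (memvf b)) big1 // => j _.
by have /eqP := t0 i j; rewrite !mxE mulf_eq0 (negPf ai) => /eqP->; rewrite scale0r.
Qed.

Lemma tensor_one_neq0 : tensor_one != 0.
Proof. by apply/eqP => /tensor_eq0[] /eqP; rewrite oner_eq0. Qed.

HB.instance Definition _ := GRing.Zmodule_isNzRing.Build T
  tensor_mulA tensor_mul1 tensor_mulr1 tensor_mulDl tensor_mulDr tensor_one_neq0.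

Lemma tensor_scaleAl (c : K) (x y : T) : c *: (x * y) = c *: x * y.
Proof.
have := tensor_mull_linear y c x 0; rewrite addr0 => /esym.
by rewrite -[tensor_mul 0 y]/(0 * y) mul0r addr0.
Qed.

Lemma tensor_scaleAr (c : K) (x y : T) : c *: (x * y) = x * (c *: y).
Proof.
have := tensor_mulr_linear x c y 0; rewrite addr0 => /esym.
by rewrite -[tensor_mul x 0]/(x * 0) mulr0 addr0.
Qed.

HB.instance Definition _ :=
  GRing.Lmodule_isLalgebra.Build K T tensor_scaleAl.
HB.instance Definition _ :=
  GRing.Lalgebra_isAlgebra.Build K T tensor_scaleAr.
HB.instance Definition _ := Algebra_isFalgebra.Build K T.

Lemma tensorM (a a' : A) (b b' : B) :
  tensor a b * tensor a' b' = tensor (a * a') (b * b').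
Proof. exact: tensor_mulE. Qed.

Lemma tensor11 : tensor 1 1 = 1.
Proof. by []. Qed.

End TensorAlgebra.

Section TableAlgebra.
Variables (R : realType) (A : falgType R[i]) (b : 3.-tuple A).

Definition struct_const (i j h : 'I_3) : R[i] :=
  coord b h (tnth b i * tnth b j).

(* On R[i], 0 <= z means that z is a nonnegative real. *)
Record table_algebra3 (delta : 'AHom(A, R[i]^o)) : Prop := TableAlgebra3 {
  ta_mulC : commutative (@GRing.mul A);
  ta_basis : basis_of {:A} b;
  ta_one : tnth b 0 = 1;
  ta_ge0 : forall i j h, 0 <= struct_const i j h;
  ta_orth : forall i j, i != j -> struct_const i j 0 = 0;
  ta_valency : forall i, struct_const i i 0 = delta (tnth b i);
  ta_integral : forall i, exists2 n : nat, (0 < n)%N & delta (tnth b i) = n%:R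
}.

(* The irreducible characters of a commutative complex algebra are its algebra
   homomorphisms to the base field. *)
Definition has_character_table (delta : 'AHom(A, R[i]^o)) (P : 'M[R[i]]_3) :=
  exists chi : 'I_3 -> 'AHom(A, R[i]^o),
    [/\ injective chi, forall phi, exists i, phi = chi i, chi 0 = delta
      & forall i j, P i j = chi i (tnth b j)].

(* tensor_basis_elt (3 * j + i + 1) = A_i (x) A_j *)
Definition tensor_basis_elt (t : nat) : tensor_alg A A :=
  tensor b`_(t.-1 %% 3) b`_(t.-1 %/ 3).

Definition fusion_space (tau : seq (seq nat)) : {vspace tensor_alg A A} :=
  <<tensor_basis_elt 1%N ::
     [seq (\sum_(t <- T) tensor_basis_elt t)%R | T <- tau]>>%VS.

Definition gives_fusion (tau : seq (seq nat)) : Prop :=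
  {in fusion_space tau &, forall x y, x * y \in fusion_space tau}.

End TableAlgebra.

Definition partition_2_9 (tau : seq (seq nat)) : bool :=
  ([::] \notin tau) && perm_eq (flatten tau) (iota 2 8).

Definition imprimitive_table (R : realType) (r m : R[i]) : 'M[R[i]]_3 :=
  \matrix_(i, j) (nth [::] [:: [:: 1; r; m * (1 + r)];
                              [:: 1; r; - 1 - r];
                              [:: 1; - 1; 0]] i)`_j.

Definition fusion_partitions : seq (seq (seq nat)) :=
  ([::
   [:: [:: 2]; [:: 3]; [:: 4]; [:: 5]; [:: 6]; [:: 7; 8]; [:: 9]];
   [:: [:: 2]; [:: 3; 6]; [:: 4]; [:: 5]; [:: 7]; [:: 8]; [:: 9]];
   [:: [:: 2]; [:: 3]; [:: 4]; [:: 5]; [:: 6]; [:: 7; 8; 9]];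
   [:: [:: 2]; [:: 3]; [:: 4; 5]; [:: 6]; [:: 7; 8]; [:: 9]];
   [:: [:: 2]; [:: 3; 6]; [:: 4]; [:: 5]; [:: 7; 8]; [:: 9]];
   [:: [:: 2]; [:: 3; 6; 9]; [:: 4]; [:: 5]; [:: 7]; [:: 8]];
   [:: [:: 2; 5]; [:: 3; 6]; [:: 4]; [:: 7]; [:: 8]; [:: 9]];
   [:: [:: 2]; [:: 3]; [:: 4; 5]; [:: 6]; [:: 7; 8; 9]];
   [:: [:: 2]; [:: 3; 6]; [:: 4; 5]; [:: 7; 8]; [:: 9]];
   [:: [:: 2]; [:: 3; 6; 7; 8]; [:: 4]; [:: 5]; [:: 9]];
   [:: [:: 2]; [:: 3; 6; 9]; [:: 4]; [:: 5]; [:: 7; 8]];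
   [:: [:: 2; 4]; [:: 3; 6]; [:: 5]; [:: 7; 8]; [:: 9]];
   [:: [:: 2]; [:: 3; 6]; [:: 4]; [:: 5]; [:: 7; 8; 9]];
   [:: [:: 2; 5]; [:: 3; 6]; [:: 4]; [:: 7; 8]; [:: 9]];
   [:: [:: 2; 5]; [:: 3; 6; 9]; [:: 4]; [:: 7]; [:: 8]];
   [:: [:: 2]; [:: 3; 6]; [:: 4; 5]; [:: 7; 8; 9]];
   [:: [:: 2; 5]; [:: 3; 6; 9]; [:: 4]; [:: 7; 8]];
   [:: [:: 2]; [:: 3]; [:: 4; 5; 6]; [:: 7; 8; 9]];
   [:: [:: 2]; [:: 3; 6; 7; 8; 9]; [:: 4]; [:: 5]];
   [:: [:: 2; 5; 8]; [:: 3; 6; 9]; [:: 4]; [:: 7]];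
   [:: [:: 2]; [:: 3]; [:: 4; 5; 7; 8]; [:: 6; 9]];
   [:: [:: 2; 3]; [:: 4]; [:: 5; 6]; [:: 7; 8; 9]];
   [:: [:: 2; 4; 5]; [:: 3; 6]; [:: 7; 8]; [:: 9]];
   [:: [:: 2; 3; 5; 6]; [:: 4]; [:: 7]; [:: 8; 9]];
   [:: [:: 2]; [:: 3; 6; 9]; [:: 4; 7]; [:: 5; 8]];
   [:: [:: 2]; [:: 3; 6; 7; 8]; [:: 4; 5]; [:: 9]];
   [:: [:: 2]; [:: 3; 6; 9]; [:: 4; 5]; [:: 7; 8]];
   [:: [:: 2; 4]; [:: 3; 6; 7; 8]; [:: 5]; [:: 9]];
   [:: [:: 2; 5]; [:: 3; 6]; [:: 4]; [:: 7; 8; 9]];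
   [:: [:: 2; 5]; [:: 3; 6; 7; 8]; [:: 4]; [:: 9]];
   [:: [:: 2; 4]; [:: 3; 6]; [:: 5]; [:: 7; 8; 9]];
   [:: [:: 2; 4]; [:: 3; 6; 9]; [:: 5]; [:: 7; 8]];
   [:: [:: 2]; [:: 3; 4; 5; 6]; [:: 7; 8; 9]];
   [:: [:: 2]; [:: 3; 6; 7; 8; 9]; [:: 4; 5]];
   [:: [:: 2; 4]; [:: 3; 6; 7; 8; 9]; [:: 5]];
   [:: [:: 2; 5; 7; 8]; [:: 4]; [:: 3; 6; 9]];
   [:: [:: 2; 3; 5; 6]; [:: 4]; [:: 7; 8; 9]];
   [:: [:: 2; 4; 5]; [:: 3; 6]; [:: 7; 8; 9]];
   [:: [:: 2; 4; 5]; [:: 3; 6; 9]; [:: 7; 8]];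
   [:: [:: 2; 5]; [:: 3; 6; 7; 8; 9]; [:: 4]];
   [:: [:: 2; 4; 5]; [:: 3; 6; 7; 8]; [:: 9]];
   [:: [:: 2]; [:: 3; 6; 9]; [:: 4; 5; 7; 8]];
   [:: [:: 2]; [:: 3; 4; 5; 6; 7; 8; 9]];
   [:: [:: 2; 3; 4; 5; 6]; [:: 7; 8; 9]];
   [:: [:: 2; 3; 5; 6; 7; 8; 9]; [:: 4]];
   [:: [:: 2; 4; 5; 7; 8]; [:: 3; 6; 9]];
   [:: [:: 2; 4; 5]; [:: 3; 6; 7; 8; 9]]
  ])%N.

(* Main.v *)
Require Import Defs.
From HB Require Import structures.
From mathcomp Require Import all_boot all_order all_algebra all_field.
From mathcomp Require Import complex reals ring.

Set Implicit Arguments.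
Unset Strict Implicit.
Unset Printing Implicit Defensive.

Import GRing.Theory Num.Theory.
Local Open Scope ring_scope.

(* The character table separates the elements of A, hence forces
     A_1^2 = r A_0 + (r - 1) A_1,   A_1 A_2 = r A_2,
     A_2^2 = l A_0 + l A_1 + (l - r - 1) A_2,   with l = m (1 + r).
   In the variables p = r - 1 and q = l - r - 1 all these structure constants
   are polynomials with natural coefficients, so a product of basis elements
   of the tensor square is a finite multiset of terms p^i q^j C_t.  A partition
   gives a fusion once, in every product of two block sums, the multiset of
   monomials attached to C_t depends only on the block of t; this is decided by
   computation for each partition of the list. *)

(** By bilinearity of the product, closure only has to be tested on generators. *)
Lemma span_mul_closed (K : fieldType) (A : falgType K) (X : seq A) :
    {in X &, forall x y, x * y \in <<X>>%VS} ->
  {in <<X>>%VS &, forall x y, x * y \in <<X>>%VS}.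
Proof.
move=> XX x y /(@coord_span _ _ _ (in_tuple X)) -> /(@coord_span _ _ _ (in_tuple X)) ->.
rewrite mulr_suml; apply: memv_suml => i _.
rewrite mulr_sumr; apply: memv_suml => j _.
rewrite -scalerAl -scalerAr; do 2!apply: memvZ.
by apply: XX; apply: mem_nth; rewrite ltn_ord.
Qed.

Section TensorLeft.
Variables (K : fieldType) (A B : falgType K).

Lemma tensorZl (c : K) (a : A) (b : B) : tensor (c *: a) b = c *: tensor a b.
Proof. by apply/matrixP => i j; rewrite !mxE linearZ mulrA. Qed.

Lemma tensor_suml (I : Type) (s : seq I) (F : I -> A) (b : B) :
  tensor (\sum_(i <- s) F i) b = \sum_(i <- s) tensor (F i) b.
Proof.
apply/matrixP => i j; rewrite summxE !mxE linear_sum mulr_suml.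
by apply: eq_bigr => k _; rewrite mxE.
Qed.

End TensorLeft.

(* A term (i, j, t) stands for p ^+ i * q ^+ j times the t-th basis element;
   coefficients larger than 1 are encoded by repetition. *)
Definition term := ((nat * nat) * nat)%type.

(** Since r = p + 1 and l = q + p + 2, [r u] and [l u] spell out r A_u and l A_u with unit
    coefficients. *)
Definition mul3_table : seq (seq (seq term)) :=
  let r u := [:: (1, 0, u); (0, 0, u)]%N in
  let l u := [:: (0, 1, u); (1, 0, u); (0, 0, u); (0, 0, u)]%N in
  [:: [:: [:: (0, 0, 0)]; [:: (0, 0, 1)]; [:: (0, 0, 2)]];
      [:: [:: (0, 0, 1)]; r 0 ++ [:: (1, 0, 1)]; r 2];
      [:: [:: (0, 0, 2)]; r 2; l 0 ++ l 1 ++ [:: (0, 1, 2)]]]%N.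

(** Indices above 2 give the empty list, just as [nth 0 b] vanishes there. *)
Definition mul3 (i j : nat) : seq term := nth [::] (nth [::] mul3_table i) j.

Lemma mul3_lt i j u : u \in mul3 i j -> (u.2 < 3)%N.
Proof.
rewrite /mul3; do 3?[case: i => [|i]]; do 3?[case: j => [|j]];
  rewrite //= ?nth_nil //= !inE; by do ?[case/predU1P => [->//|]]; move/eqP->.
Qed.

(** The new index follows the numbering C_{3j+i+1} of the tensor of A_i and A_j. *)
Definition tensor_term (u v : term) : term :=
  ((u.1.1 + v.1.1, u.1.2 + v.1.2), (3 * v.2 + u.2).+1)%N.

Definition mul9 (s t : nat) : seq term :=
  [seq tensor_term u v | u <- mul3 (s.-1 %% 3) (t.-1 %% 3),
                         v <- mul3 (s.-1 %/ 3) (t.-1 %/ 3)].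

Definition block_mul (S T : seq nat) : seq term :=
  flatten [seq mul9 s t | s <- S, t <- T].

Definition coef_terms (W : seq term) (t : nat) : seq (nat * nat) :=
  [seq w.1 | w <- W & w.2 == t].

Definition block_constant (B : seq (seq nat)) (W : seq term) : bool :=
  all (fun w => w.2 \in flatten B) W &&
  all (fun T => all (fun t => perm_eq (coef_terms W t)
                                (coef_terms W (head 0%N T))) T) B.

(** Comparing multisets of exponents treats p and q as indeterminates, so one computation serves all
    r and m. The added block [[:: 1]] carries the unit C_1. *)
Definition fusion_check (tau : seq (seq nat)) : bool :=
  let B := [:: 1%N] :: tau in
  uniq (flatten B) &&
  all (fun S => all (fun T => block_constant B (block_mul S T)) B) B.

Lemma fusion_partitions_check : all fusion_check fusion_partitions.
Proof. by vm_compute. Qed.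

Lemma fusion_partitions_partition : all partition_2_9 fusion_partitions.
Proof. by vm_compute. Qed.

Section Evaluation.
Variables (K : comNzRingType) (V : lmodType K) (p q : K) (C : nat -> V).

Definition monomial_eval (e : nat * nat) : K := p ^+ e.1 * q ^+ e.2.

Definition term_eval (w : term) : V := monomial_eval w.1 *: C w.2.

Lemma block_constant_eval B W : uniq (flatten B) -> block_constant B W ->
  exists c : seq nat -> K,
    \sum_(w <- W) term_eval w = \sum_(T <- B) c T *: \sum_(t <- T) C t.
Proof.
move=> uB /andP[/allP WB /allP cB].
(* The coefficient of a block is read at its first index; block constancy gives the same value at
   the others. *)
exists (fun T => \sum_(e <- coef_terms W (head 0%N T)) monomial_eval e).
(* Terms are sorted by index; as [flatten B] has no repetition, each term is counted exactly
   once. *)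
transitivity (\sum_(t <- flatten B) \sum_(w <- W | w.2 == t) term_eval w).
  rewrite (exchange_big_dep predT) //=.
  rewrite big_seq [RHS]big_seq; apply: eq_bigr => w /WB wB.
  under eq_bigl do rewrite eq_sym.
  by rewrite -big_filter filter_pred1_uniq // big_seq1.
rewrite big_flatten /= big_seq [RHS]big_seq; apply: eq_bigr => T /cB/allP cT.
rewrite scaler_sumr big_seq [RHS]big_seq; apply: eq_bigr => t /cT ct.
rewrite -(perm_big _ ct) /= big_map big_filter scaler_suml.
by apply: eq_bigr => w /eqP <-.
Qed.

End Evaluation.

Section TensorSquare.
Variables (R : realType) (A : falgType R[i]) (b : 3.-tuple A) (p q : R[i]).

Hypothesis mul3E : forall i j : nat,
  b`_i * b`_j = \sum_(u <- mul3 i j) term_eval p q (nth 0 b) u.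

Local Notation C := (tensor_basis_elt b).

Lemma tensor_term_eval (u v : term) : (u.2 < 3)%N ->
  tensor (term_eval p q (nth 0 b) u) (term_eval p q (nth 0 b) v)
    = term_eval p q C (tensor_term u v).
Proof.
(* With [u.2 < 3], division of 3 * v.2 + u.2 by 3 returns both indices. *)
move=> u3; rewrite /term_eval /tensor_basis_elt /= mulnC divnMDl // modnMDl.
rewrite divn_small // modn_small // addn0.
rewrite tensorZl linearZ /= scalerA; congr (_ *: _).
by rewrite /monomial_eval /= !exprD; ring.
Qed.

Lemma mul9E (s t : nat) :
  C s * C t = \sum_(w <- mul9 s t) term_eval p q C w.
Proof.
rewrite {1 2}/tensor_basis_elt tensorM !mul3E tensor_suml big_allpairs_dep /=.
rewrite big_seq [RHS]big_seq; apply: eq_bigr => u /mul3_lt u3.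
by rewrite linear_sum; apply: eq_bigr => v _; rewrite /= tensor_term_eval.
Qed.

Lemma block_mulE (S T : seq nat) :
  (\sum_(s <- S) C s) * (\sum_(t <- T) C t)
    = \sum_(w <- block_mul S T) term_eval p q C w.
Proof.
rewrite big_flatten /= big_allpairs_dep /= mulr_suml; apply: eq_bigr => s _.
by rewrite mulr_sumr; apply: eq_bigr => t _; rewrite mul9E.
Qed.

Lemma fusion_check_gives_fusion tau : fusion_check tau -> gives_fusion b tau.
Proof.
move=> /andP[uB /allP cB].
have fE : fusion_space b tau
    = <<[seq (\sum_(t <- T) C t)%R | T <- [:: 1%N] :: tau]>>%VS.
  by rewrite /fusion_space /= big_seq1.
rewrite /gives_fusion fE; apply: span_mul_closed => _ _ /mapP[S SB ->] /mapP[T TB ->].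
have /allP/(_ T TB) := cB S SB.
move=> /(block_constant_eval p q C uB)[c]; rewrite block_mulE => ->.
rewrite big_seq; apply: memv_suml => U UB; apply/memvZ/memv_span.
exact: map_f UB.
Qed.

End TensorSquare.

Section ImprimitiveTable.
Variables (R : realType) (A : falgType R[i]) (b : 3.-tuple A).
Variables (delta : 'AHom(A, R[i]^o)) (r m : R[i]).
Hypotheses (tA : table_algebra3 b delta)
           (hT : has_character_table b delta (imprimitive_table r m)).

Local Notation l := (m * (1 + r)).

Lemma imprimitive_mul :
  [/\ b`_1 * b`_1 = r *: 1 + (r - 1) *: b`_1, b`_1 * b`_2 = r *: b`_2
    & b`_2 * b`_2 = l *: 1 + l *: b`_1 + (l - r - 1) *: b`_2].
Proof.
case: hT => chi [_ _ chi0 chiE].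
have b0 : b`_0 = 1 by rewrite -(ta_one tA) (tnth_nth 0).
have chi1 i : chi i 1 = 1 by rewrite rmorph1.
have chiD i x y : chi i (x + y) = (chi i x + chi i y : R[i]) by rewrite linearD.
have chiZ i c x : chi i (c *: x) = (c * chi i x : R[i]) by rewrite linearZ.
have chiM i x y : chi i (x * y) = (chi i x * chi i y : R[i]) by rewrite rmorphM.
have chib i (j : 'I_3) k : j = k :> nat -> chi i b`_k = imprimitive_table r m i j.
  by move=> <-; rewrite chiE (tnth_nth 0).
pose o1 : 'I_3 := inord 1; pose o2 : 'I_3 := inord 2.
have e1 : o1 = 1%N :> nat by rewrite inordK.
have e2 : o2 = 2%N :> nat by rewrite inordK.
have C01 : chi 0 b`_1 = r by rewrite (chib _ _ _ e1) !mxE e1.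
have C02 : chi 0 b`_2 = l by rewrite (chib _ _ _ e2) !mxE e2.
have C11 : chi o1 b`_1 = r by rewrite (chib _ _ _ e1) !mxE e1.
have C12 : chi o1 b`_2 = - 1 - r by rewrite (chib _ _ _ e2) !mxE e1 e2.
have C21 : chi o2 b`_1 = - 1 by rewrite (chib _ _ _ e1) !mxE e1 e2.
have C22 : chi o2 b`_2 = 0 by rewrite (chib _ _ _ e2) !mxE e2.
(* Valencies are positive integers, so both numbers are positive integers as well. *)
have rl0 : 1 + r != 0 /\ l + (1 + r) != 0.
  have [n n0] := ta_integral tA o1; rewrite (tnth_nth 0) e1 -chi0 C01 => rE.
  have [k k0] := ta_integral tA o2; rewrite (tnth_nth 0) e2 -chi0 C02 => lE.
  by rewrite lE rE !nat1r -natrD !pnatr_eq0 addnS.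
(* The coordinates of x - y solve a homogeneous system with determinant -(1 + r)(l + 1 + r). *)
have sep x y : chi 0 x = chi 0 y -> chi o1 x = chi o1 y -> chi o2 x = chi o2 y -> x = y.
  move=> h0 h1 h2; apply/eqP; rewrite -subr_eq0; apply/eqP.
  have {h0 h1 h2} [] : [/\ chi 0 (x - y) = 0, chi o1 (x - y) = 0 & chi o2 (x - y) = 0].
    by rewrite !linearB /= h0 h1 h2 !subrr.
  rewrite (coord_basis (ta_basis tA) (memvf (x - y))).
  rewrite !big_ord_recl big_ord0 /= /bump /= !addn0 b0 addr0.
  set c0 := coord _ _ _; set c1 := coord _ _ _; set c2 := coord _ _ _.
  rewrite !chiD !chiZ !chi1 C01 C02 C11 C12 C21 C22 => h0 h1 h2.
  have {h2} E1 : c0 = c1 by apply/eqP; rewrite -subr_eq0 -h2; apply/eqP; ring.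
  (* The first two character equations differ only in their c2 terms. *)
  have : c2 * (l + (1 + r)) = 0 by rewrite -[RHS](subrr 0) -{1}h0 -h1; ring.
  move=> /eqP; rewrite mulf_eq0 (negPf rl0.2) orbF => /eqP c20.
  have : c1 * (1 + r) = 0 by rewrite -h0 c20 E1; ring.
  move=> /eqP; rewrite mulf_eq0 (negPf rl0.1) orbF => /eqP c10.
  by rewrite E1 c10 c20 !scale0r !addr0.
by split; apply: sep;
  rewrite ?chiD ?chiZ ?chiM ?chi1 ?C01 ?C02 ?C11 ?C12 ?C21 ?C22; ring.
Qed.

End ImprimitiveTable.

Theorem theorem4p2 (R : realType) (A : falgType R[i]) (b : 3.-tuple A)
    (delta : 'AHom(A, R[i]^o)) (r m : R[i]) :
  table_algebra3 b delta ->
  has_character_table b delta (imprimitive_table r m) ->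
  forall tau, tau \in fusion_partitions -> partition_2_9 tau /\ gives_fusion b tau.
Proof.
move=> tA hT tau tauF; split; first exact: (allP fusion_partitions_partition).
have b0 : b`_0 = 1 by rewrite -(ta_one tA) (tnth_nth 0).
have [b11 b12 b22] := imprimitive_mul tA hT.
apply: (@fusion_check_gives_fusion _ _ _ (r - 1) (m * (1 + r) - r - 1));
  last exact: (allP fusion_partitions_check).
have b21 : b`_2 * b`_1 = r *: b`_2 by rewrite (ta_mulC tA).
have bD i : b`_i.+3 = 0 by rewrite nth_default ?size_tuple.
have rZ (x : A) : (r - 1) *: x + x = r *: x by rewrite scalerBl scale1r subrK.
(* This is l = q + p + 1 + 1, in the order of the terms of [l u] in the table. *)
have lZ (x y : A) :
    (m * (1 + r) - r - 1) *: x + ((r - 1) *: x + (x + (x + y)))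
      = (m * (1 + r)) *: x + y.
  rewrite !addrA -[x in _ + x + x + _]scale1r -!scalerDl.
  by congr (_ *: _ + _); ring.
(* Nine cases are table entries; in the others both sides vanish. *)
case=> [|[|[|i]]] [|[|[|j]]];
  rewrite ?b0 ?bD ?mulr1 ?mul1r ?mulr0 ?mul0r ?b11 ?b12 ?b21 ?b22;
  rewrite /mul3 /= ?nth_nil ?big_cons big_nil /term_eval /monomial_eval /= ?b0;
  rewrite ?expr0 ?expr1 ?mulr1 ?mul1r ?scale1r ?addr0 ?lZ ?rZ ?addrA ?rZ //.
Qed.
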